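(* Let $R$ be an associative ring with unit. Then every right $R$-module has an fp-injective preenvelope.
   Context: A right $R$-module $E$ is fp-injective if for every natural number $n$ and every finitely generated submodule $K$ of $R^n$, each morphism $K \to E$ extends to a morphism $R^n \to E$. An fp-injective preenvelope of a module $M$ is a morphism $u : M \to E$ with $E$ fp-injective such that any morphism $M \to E'$ with $E'$ fp-injective factors through $u$. *)

(* Defs.v *)
From HB Require Import structures.
From mathcomp Require Import all_boot all_order all_algebra.
Set Implicit Arguments.
Unset Strict Implicit.
Unset Printing Implicit Defensive.
Import GRing.Theory.
Local Open Scope ring_scope.

(** Rings are [pzRingType]s, so that the zero ring is not excluded.  Right
    modules over [R] are left modules over the converse ring [R^c]: for
    [E : rmodType R], [a *: x] is the product of [x] by [a] on the right.  The
    right module [R^n] is ['rV[R^c]_n], where [(a *: v) 0 i] is [v 0 i * a],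
    computed in [R]. *)
Notation rmodType R := (lmodType R^c).

Definition finitely_generated (R : pzRingType) (K : rmodType R) : Prop :=
  exists (m : nat) (e : 'I_m -> K),
    forall x : K, exists a : 'I_m -> R^c, x = \sum_(i < m) a i *: e i.

(** A submodule of [R^n] is a [subLmodType S], with [S] its set of elements and
    [\val] its inclusion.  Classically [S] is an arbitrary subset; nothing
    requires it to be detachable. *)
Definition fp_injective (R : pzRingType) (E : rmodType R) : Prop :=
  forall (n : nat) (S : {pred 'rV[R^c]_n}) (K : subLmodType S),
    finitely_generated K ->
    forall f : {linear K -> E},
      exists g : {linear 'rV[R^c]_n -> E}, forall x : K, g (\val x) = f x.

Definition fp_injective_preenvelope (R : pzRingType) (M E : rmodType R)
    (u : {linear M -> E}) : Prop :=
  fp_injective E /\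
  forall E' : rmodType R, fp_injective E' ->
    forall f : {linear M -> E'},
      exists g : {linear E -> E'}, forall x : M, g (u x) = f x.

(* Main.v *)
Require Import Defs.
From HB Require Import structures.
From mathcomp Require Import all_boot all_order all_algebra.
From mathcomp Require Import boolp.
Set Implicit Arguments.
Unset Strict Implicit.
Unset Printing Implicit Defensive.
Import GRing.Theory.
Local Open Scope ring_scope.
Local Open Scope quotient_scope.

(** The preenvelope is obtained by freely adjoining to [M] a solution of every
    extension problem.  A problem is given by generators [e i] of a submodule of
    [R^n] and by their images [s i]; the [n] elements [TExt e s j] stand for the
    images of the basis vectors.  Terms are built from [M], the module
    operations and these symbols, and are identified by the least module
    congruence for which [TExt e s] extends [e i |-> s i] whenever every linear
    relation between the [e i] holds between the [s i] too.  That proviso occurs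
    positively, so the congruence is an inductive relation, and the quotient
    solves its own extension problems without any transfinite iteration.  A map
    from [M] to an fp-injective [E'] extends to terms by structural recursion,
    with chosen extensions in [E'] for the [TExt], and respects the congruence
    by induction. *)

(** * Spans of finite families and linear maps out of them *)

Lemma sum_delta_scale (R : pzRingType) (V : lmodType R) (m : nat)
    (e : 'I_m -> V) (i : 'I_m) : \sum_j (j == i)%:R *: e j = e i.
Proof.
rewrite (bigD1 i) //= eqxx scale1r big1 ?addr0 // => j /negPf->.
by rewrite scale0r.
Qed.

Section Span.
Variables (R : pzRingType) (V : lmodType R) (m : nat) (e : 'I_m -> V).

Definition in_span : {pred V} :=
  fun v => `[< exists a : 'I_m -> R, v = \sum_i a i *: e i >].

Lemma in_span_submod : submod_closed in_span.
Proof.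
split=> [|c u v /asboolP[a ->] /asboolP[b ->]]; apply/asboolP.
  by exists (fun=> 0); rewrite big1 // => i _; rewrite scale0r.
exists (fun i => c * a i + b i); rewrite scaler_sumr -big_split.
by apply: eq_bigr => i _; rewrite scalerDl scalerA.
Qed.

HB.instance Definition _ := GRing.isSubmodClosed.Build R V in_span
  in_span_submod.

Record span := Span { span_val : V; _ : span_val \in in_span }.

HB.instance Definition _ := [isSub for span_val].
HB.instance Definition _ := [Choice of span by <:].
HB.instance Definition _ := [SubChoice_isSubLmodule of span by <:].

Lemma span_coefs :
  exists a : span -> 'I_m -> R, forall x, \val x = \sum_i a x i *: e i.
Proof.
have /choice[a aE] : forall x : span,
    exists a : 'I_m -> R, \val x = \sum_i a i *: e i.
  by move=> x; apply: asboolW (valP x).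
by exists a.
Qed.

Lemma in_span_gen i : e i \in in_span.
Proof.
apply/asboolP; exists (fun j => (j == i)%:R).
by rewrite sum_delta_scale.
Qed.

Lemma span_generated (x : span) :
  exists a : 'I_m -> R, x = \sum_i a i *: Span (in_span_gen i).
Proof.
have [a aE] := span_coefs; exists (a x); apply: val_inj.
by rewrite aE linear_sum; apply: eq_bigr => i _; rewrite linearZ.
Qed.

(** By hypothesis, two coefficient families of the same vector give the same combination of the
    [y i], so any choice of coefficients defines the map. *)
Lemma span_linear (W : lmodType R) (y : 'I_m -> W) :
  (forall a : 'I_m -> R, \sum_i a i *: e i = 0 -> \sum_i a i *: y i = 0) ->
  exists f : {linear span -> W}, forall i, f (Span (in_span_gen i)) = y i.
Proof.
move=> ey.
have eyB (a b : 'I_m -> R) : \sum_i a i *: e i = \sum_i b i *: e i ->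
    \sum_i a i *: y i = \sum_i b i *: y i.
  move=> ab; apply/eqP; rewrite -subr_eq0 -sumrB; apply/eqP.
  under eq_bigr do rewrite -scalerBl.
  apply: ey; under eq_bigr do rewrite scalerBl.
  by rewrite sumrB ab subrr.
have [coef coefE] := span_coefs.
pose f0 (x : span) := \sum_i coef x i *: y i.
have f0E (x : span) (a : 'I_m -> R) :
    \val x = \sum_i a i *: e i -> f0 x = \sum_i a i *: y i.
  by move=> xE; apply: eyB; rewrite -coefE.
have f0_linear : linear f0.
  (* The coefficients chosen for [c *: u + v] need not be this combination, but [f0E] allows any
     valid family. *)
  move=> c u v; rewrite (f0E _ (fun i => c * coef u i + coef v i)).
    rewrite scaler_sumr -big_split; apply: eq_bigr => i _.
    by rewrite scalerDl scalerA.
  rewrite linearP /= !coefE scaler_sumr -big_split; apply: eq_bigr => i _.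
  by rewrite /= scalerDl scalerA.
pose f : {linear span -> W} :=
  HB.pack f0 (GRing.isLinear.Build _ _ _ _ f0 f0_linear).
by exists f => i; rewrite /= (f0E _ (fun j => (j == i)%:R)) /= sum_delta_scale.
Qed.

End Span.

(** Restates fp-injectivity by generators and relations, the form in which extension problems enter
    terms: [span_linear] gives a map on the span, which then extends. *)
Lemma fp_injective_extend (R : pzRingType) (E : rmodType R) (n m : nat)
    (e : 'I_m -> 'rV[R^c]_n) (y : 'I_m -> E) :
  fp_injective E ->
  (forall a : 'I_m -> R^c, \sum_i a i *: e i = 0 -> \sum_i a i *: y i = 0) ->
  exists g : {linear 'rV[R^c]_n -> E}, forall i, g (e i) = y i.
Proof.
move=> Einj /span_linear[f fE].
have [|g gE] := Einj n _ (span e : subLmodType (in_span e)) _ f.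
  by exists m, (fun i => Span (in_span_gen e i)); apply: span_generated.
by exists g => i; rewrite -fE -gE.
Qed.

(** * Terms over a module and their quotient *)

Section Envelope.
Variables (R : pzRingType) (M : rmodType R).

(** [TExt] accepts inconsistent data too; consistency depends on the congruence, which is defined
    only afterwards. *)
Inductive term : Type :=
| TIn of M
| TAdd of term & term
| TScale of R^c & term
| TExt n m (e : 'I_m -> 'rV[R^c]_n) (s : 'I_m -> term) (j : 'I_n).

Definition lincomb m (a : 'I_m -> R^c) (s : 'I_m -> term) : term :=
  \big[TAdd/TIn 0]_i TScale (a i) (s i).

Inductive eqt : term -> term -> Prop :=
| eqt_refl t : eqt t t
| eqt_sym s t : eqt s t -> eqt t s
| eqt_trans s t u : eqt s t -> eqt t u -> eqt s u
| eqt_add s s' t t' : eqt s s' -> eqt t t' -> eqt (TAdd s t) (TAdd s' t')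
| eqt_scale a t t' : eqt t t' -> eqt (TScale a t) (TScale a t')
| eqt_addA s t u : eqt (TAdd s (TAdd t u)) (TAdd (TAdd s t) u)
| eqt_addC s t : eqt (TAdd s t) (TAdd t s)
| eqt_add0 t : eqt (TAdd (TIn 0) t) t
| eqt_addN t : eqt (TAdd (TScale (- 1) t) t) (TIn 0)
| eqt_scaleA a b t : eqt (TScale a (TScale b t)) (TScale (a * b) t)
| eqt_scale1 t : eqt (TScale 1 t) t
| eqt_scaleDr a s t :
    eqt (TScale a (TAdd s t)) (TAdd (TScale a s) (TScale a t))
| eqt_scaleDl t a b :
    eqt (TScale (a + b) t) (TAdd (TScale a t) (TScale b t))
| eqt_inP a x y : eqt (TIn (a *: x + y)) (TAdd (TScale a (TIn x)) (TIn y))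
(* The left side is the value at [e i], expanded in coordinates, of the map sending the [j]-th basis
   vector to [TExt e s j]. *)
| eqt_ext n m (e : 'I_m -> 'rV[R^c]_n) (s : 'I_m -> term) :
    (forall a : 'I_m -> R^c,
       \sum_i a i *: e i = 0 -> eqt (lincomb a s) (TIn 0)) ->
    forall i, eqt (lincomb (fun j => e i 0 j) (TExt e s)) (s i).

HB.instance Definition _ := gen_eqMixin term.
HB.instance Definition _ := gen_choiceMixin term.

Definition eqtb : rel term := fun s t => `[< eqt s t >].

Lemma eqtb_equiv : equiv_class_of eqtb.
Proof.
split=> [t|s t|t s u].
- exact/asboolP/eqt_refl.
- by apply/asboolP/asboolP; apply: eqt_sym.
- by move=> /asboolP st /asboolP tu; apply/asboolP; apply: eqt_trans st tu.
Qed.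

Canonical eqtb_equiv_rel := EquivRelPack eqtb_equiv.

Definition env := {eq_quot eqtb_equiv_rel}.
HB.instance Definition _ := Choice.on env.
HB.instance Definition _ := EqQuotient.on env.

Definition cls (t : term) : env := \pi_env t.

Lemma clsP s t : cls s = cls t <-> eqt s t.
Proof. by split=> [/eqmodP/asboolP//|st]; apply/eqmodP/asboolP. Qed.

Lemma cls_repr x : cls (repr x) = x.
Proof. exact: reprK. Qed.

Lemma repr_cls t : eqt (repr (cls t)) t.
Proof. by apply/clsP; rewrite cls_repr. Qed.

Definition env_add (x y : env) : env := cls (TAdd (repr x) (repr y)).
Definition env_scale (a : R^c) (x : env) : env := cls (TScale a (repr x)).

Lemma cls_add s t : cls (TAdd s t) = env_add (cls s) (cls t).
Proof. by apply/clsP/eqt_add; apply/eqt_sym/repr_cls. Qed.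

Lemma cls_scale a t : cls (TScale a t) = env_scale a (cls t).
Proof. by apply/clsP/eqt_scale; apply/eqt_sym/repr_cls. Qed.

Lemma env_ind (P : env -> Prop) : (forall t, P (cls t)) -> forall x, P x.
Proof. by move=> Pcls x; rewrite -[x]cls_repr. Qed.

Lemma env_addA : associative env_add.
Proof.
elim/env_ind=> s; elim/env_ind=> t; elim/env_ind=> u.
by rewrite -!cls_add; apply/clsP/eqt_addA.
Qed.

Lemma env_addC : commutative env_add.
Proof.
by elim/env_ind=> s; elim/env_ind=> t; rewrite -!cls_add; apply/clsP/eqt_addC.
Qed.

Lemma env_add0 : left_id (cls (TIn 0)) env_add.
Proof. by elim/env_ind=> t; rewrite -cls_add; apply/clsP/eqt_add0. Qed.

Lemma env_addN : left_inverse (cls (TIn 0)) (env_scale (- 1)) env_add.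
Proof.
by elim/env_ind=> t; rewrite -cls_scale -cls_add; apply/clsP/eqt_addN.
Qed.

HB.instance Definition _ :=
  GRing.isZmodule.Build env env_addA env_addC env_add0 env_addN.

Lemma env_scaleA a b x : env_scale a (env_scale b x) = env_scale (a * b) x.
Proof. by elim/env_ind: x => t; rewrite -!cls_scale; apply/clsP/eqt_scaleA. Qed.

Lemma env_scale1 : left_id 1 env_scale.
Proof. by elim/env_ind=> t; rewrite -cls_scale; apply/clsP/eqt_scale1. Qed.

Lemma env_scaleDr : right_distributive env_scale env_add.
Proof.
move=> a; elim/env_ind=> s; elim/env_ind=> t.
by rewrite -cls_add -!cls_scale -cls_add; apply/clsP/eqt_scaleDr.
Qed.

Lemma env_scaleDl x a b :
  env_scale (a + b) x = env_add (env_scale a x) (env_scale b x).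
Proof.
elim/env_ind: x => t.
by rewrite -!cls_scale -cls_add; apply/clsP/eqt_scaleDl.
Qed.

HB.instance Definition _ := GRing.Zmodule_isLmodule.Build R^c env
  env_scaleA env_scale1 env_scaleDr env_scaleDl.

Lemma cls_lincomb m (a : 'I_m -> R^c) (s : 'I_m -> term) :
  cls (lincomb a s) = \sum_i a i *: cls (s i).
Proof.
rewrite /lincomb; elim/big_rec2: _ => [//|i x t _ <-].
by rewrite cls_add cls_scale.
Qed.

Definition env_in (x : M) : env := cls (TIn x).

Lemma env_in_linear : linear env_in.
Proof.
move=> a x y; have /clsP := eqt_inP a x y.
by rewrite cls_add cls_scale.
Qed.

HB.instance Definition _ := GRing.isLinear.Build _ _ _ _ env_in env_in_linear.

(** The symbols [TExt] attached to generators of [K] and to representatives of their images are the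
    values of an extension on the basis; [eqt_ext] makes it agree with [f] on the generators. *)
Lemma env_fp_injective : fp_injective env.
Proof.
move=> n S K [m [e eK]] f.
pose e' i : 'rV[R^c]_n := \val (e i).
pose s i := repr (f (e i)).
have sE i : cls (s i) = f (e i) by apply: cls_repr.
pose g0 (v : 'rV[R^c]_n) : env := \sum_j v 0 j *: cls (TExt e' s j).
have g0_linear : linear g0.
  move=> a u v; rewrite /g0 scaler_sumr -big_split; apply: eq_bigr => j _.
  by rewrite !mxE scalerDl scalerA.
pose g : {linear 'rV[R^c]_n -> env} :=
  HB.pack g0 (GRing.isLinear.Build _ _ _ _ g0 g0_linear).
have gE i : g (\val (e i)) = f (e i).
  rewrite /= /g0 -cls_lincomb -sE; apply/clsP; apply: (@eqt_ext _ _ e' s).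
  (* A relation between the vectors [e' i] already holds in [K], since [\val] is injective, and [f]
     carries it to the images. *)
  move=> a ae0; apply/clsP; rewrite cls_lincomb.
  under eq_bigr do rewrite sE -linearZ.
  rewrite -linear_sum /= (_ : \sum_i _ = 0) ?raddf0 //.
  apply: val_inj; rewrite linear_sum raddf0 -[RHS]ae0.
  by apply: eq_bigr => i' _; rewrite linearZ.
exists g => x; have [a ->] := eK x.
rewrite !linear_sum; apply: eq_bigr => i _.
by rewrite !linearZ gE.
Qed.

(** * Evaluation of terms in a module *)

Section Eval.
Variables (E : rmodType R) (f : {linear M -> E}).

(** The default 0 keeps [eval] total on inconsistent data. *)
Definition extension n m (e : 'I_m -> 'rV[R^c]_n) (y : 'I_m -> E) :
    'rV[R^c]_n -> E :=
  if pselect (exists g : {linear 'rV[R^c]_n -> E}, forall i, g (e i) = y i)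
    is left ex then sval (cid ex) else fun=> 0.

Fixpoint eval (t : term) : E :=
  match t with
  | TIn x => f x
  | TAdd s t => eval s + eval t
  | TScale a t => a *: eval t
  | TExt _ _ e s j => extension e (fun i => eval (s i)) (delta_mx 0 j)
  end.

Lemma eval_lincomb m (a : 'I_m -> R^c) (s : 'I_m -> term) :
  eval (lincomb a s) = \sum_i a i *: eval (s i).
Proof.
by rewrite /lincomb; elim/big_rec2: _ => [|i x t _ <-] //=; rewrite raddf0.
Qed.

Lemma eval_eqt s t : fp_injective E -> eqt s t -> eval s = eval t.
Proof.
move=> Einj; elim=> {s t} //=.
- by move=> s t u _ -> _ ->.
- by move=> s s' t t' _ -> _ ->.
- by move=> a t t' _ ->.
- by move=> *; rewrite addrA.
- by move=> *; rewrite addrC.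
- by move=> *; rewrite raddf0 add0r.
- by move=> *; rewrite scaleN1r addNr raddf0.
- by move=> *; rewrite scalerA.
- by move=> *; rewrite scale1r.
- by move=> *; rewrite scalerDr.
- by move=> *; rewrite scalerDl.
- by move=> *; rewrite linearP.
- move=> n m e s _ IH i; rewrite eval_lincomb /= /extension.
  (* The default is excluded: by [IH] the formal relations hold in [E] after evaluation, so
     fp-injectivity yields an extension. *)
  case: pselect => [ex|[]]; last first.
    apply: fp_injective_extend => // a /IH.
    by rewrite eval_lincomb raddf0.
  (* Both sides are [g (e i)], the left one expanded in the standard basis. *)
  case: (cid ex) => g /= gE; rewrite -gE [in RHS](row_sum_delta (e i)).
  by rewrite linear_sum; apply: eq_bigr => j _; rewrite linearZ.
Qed.

Lemma env_extend :
  fp_injective E -> exists g : {linear env -> E}, forall x, g (env_in x) = f x.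
Proof.
move=> Einj; pose g0 (x : env) := eval (repr x).
have g0E t : g0 (cls t) = eval t by apply: eval_eqt (repr_cls t).
have g0_linear : linear g0.
  move=> a; elim/env_ind=> s; elim/env_ind=> t.
  (* Once the operations are moved inside [cls], linearity is the recursion defining [eval]. *)
  rewrite [a *: cls s](esym (cls_scale a s)).
  by rewrite [_ + cls t](esym (cls_add _ t)) !g0E.
pose g : {linear env -> E} :=
  HB.pack g0 (GRing.isLinear.Build _ _ _ _ g0 g0_linear).
by exists g => x; rewrite /= g0E.
Qed.

End Eval.
End Envelope.

Theorem corollary5p3 (R : pzRingType) (M : rmodType R) :
  exists (E : rmodType R) (u : {linear M -> E}), fp_injective_preenvelope u.
Proof.
exists (env M), (@env_in R M : {linear M -> env M}).
by split=> [|E' E'inj f]; [apply: env_fp_injective | apply: env_extend].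
Qed.
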